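(* Let $R_1,\dots,R_n$ be processes such that $R_i\vdash\Sigma_i,x_i{:}A_i$ is derivable in CP for every $i\le n$, and let $Q$ be a forwarder with $Q\Vdash\{x_i{:}A_i'\}_{i\le n}$ (all queues empty), where each $A_i'$ is an annotated type with $\llcorner A_i'\lrcorner=A_i^\perp$. Then there exists a process $S$ such that $(\nu\,\tilde x:Q)(R_1\mid\dots\mid R_n)\Rightarrow^*S$ and $S\vdash\Sigma_1,\dots,\Sigma_n$ is derivable in CP.
   Context: We write $\wp$ for the ''par'' connective of linear logic. **Types.** $A::=a\mid a^\perp\mid 1\mid\bot\mid A\otimes A\mid A\wp A$, with the usual involutive duality: $(a^\perp)^\perp=a$, $1^\perp=\bot$, $(A\otimes B)^\perp=A^\perp\wp B^\perp$. **Annotated types:** $B::=a\mid a^\perp\mid 1^{u_1,\dots,u_n}\mid\bot^u\mid A\otimes^uB\mid A\wp^uB$, where $u,u_i$ are names (endpoints), $n\ge1$, the $u_i$ are distinct, and the left component $A$ of $\otimes^u,\wp^u$ is an unannotated type. $\llcorner B\lrcorner$ is $B$ with all annotations erased; for unannotated $A$ and a name $x$, $A(x)$ is the annotated type obtained by annotating every annotatable operator of $A$ with $x$. **Processes.** $P,Q::=x\leftrightarrow y\mid x().P\mid x[]\mid x(y).P\mid x[y\triangleright P].Q$ (link, wait, close, input binding $y$ in $P$, output binding $y$ in the spawned process $P$ and continuing as $Q$), up to renaming of bound names; links are symmetric. **CP (multiplicative, cut-free).** Judgements $P\vdash\Delta$, $\Delta$ a finite set of named unannotated types with distinct names: - $x\leftrightarrow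 y\vdash x{:}a^\perp,y{:}a$; - $x[]\vdash x{:}1$; - from $P\vdash\Delta$ infer $x().P\vdash\Delta,x{:}\bot$; - from $P\vdash\Delta_1,y{:}A_1$ and $Q\vdash\Delta_2,x{:}A_2$ infer $x[y\triangleright P].Q\vdash\Delta_1,\Delta_2,x{:}A_1\otimes A_2$; - from $P\vdash\Delta,y{:}A_1,x{:}A_2$ infer $x(y).P\vdash\Delta,x{:}A_1\wp A_2$. **Queues and contexts.** A queue is $[\![\Psi]\!]::=\varnothing\mid[^u*][\![\Psi]\!]\mid[^u\,y{:}A][\![\Psi]\!]$ with $A$ unannotated; queues are identified up to swapping adjacent boxes with different labels $u\neq v$. A forwarder context is $\Gamma::=\varnothing\mid\Gamma,[\![\Psi]\!]x{:}B\mid\Gamma,[\![\Psi]\!]x{:}\cdot$ with $B$ annotated; $x{:}\cdot$ (with a non-empty queue) is a terminated endpoint. The empty queue is omitted in writing. **Forwarder rules** (a process $Q$ is a forwarder if $Q\Vdash\Gamma$ is derivable; $C$ below is an annotated type or $\cdot$): - Ax: $x\leftrightarrow y\Vdash x{:}a^\perp,y{:}a$. - $1$: $x[]\Vdash\{[^x*]u_i{:}\cdot\}_{1\le i\le n},\,x{:}1^{u_1,\dots,u_n}$. - $\bot$: from $P\Vdash\Gamma,[\![\Psi]\!][^u*]x{:}\cdot$ infer $x().P\Vdash\Gamma,[\![\Psi]\!]x{:}\bot^u$. - $\wp$: from $P\Vdash\Gamma,[\![\Psi]\!][^u\,y{:}A]x{:}B$ infer $x(y).P\Vdash\Gamma,[\![\Psi]\!]x{:}A\wp^uB$.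 - $\otimes$: from $P\Vdash z{:}(A(y))^\perp,\,y{:}A(z)$ and $Q\Vdash\Gamma,[\![\Psi_u]\!]u{:}C,[\![\Psi_x]\!]x{:}B$ infer $x[y\triangleright P].Q\Vdash\Gamma,[^x\,z{:}A^\perp][\![\Psi_u]\!]u{:}C,[\![\Psi_x]\!]x{:}A\otimes^uB$. **Multi-compositions.** Processes are extended with terms $(\nu\,\tilde x:Q[\tilde y\lhd\tilde P])(\tilde R)$, where $Q$ is a forwarder, $\tilde P=P_1,\dots,P_m$ are the messages in transit ($P_j$ owning the endpoint $y_j$) and $\tilde R=R_1\mid\dots\mid R_n$ are the composed processes ($R_i$ owning $x_i$); the names $\tilde x$ may also include terminated endpoints not owned by any $R_i$. Order of components is irrelevant. $(\nu\,\tilde x:Q)(\tilde R)$ is the case $m=0$. **Reduction** $\Rightarrow$ is the least relation, closed under process contexts, containing: - (send) $(\nu\,x\tilde x:x(y).Q[\tilde y\lhd\tilde P])(x[y\triangleright P].R\mid\tilde R)\Rightarrow(\nu\,x\tilde x:Q[y,\tilde y\lhd P,\tilde P])(R\mid\tilde R)$; - (receive) $(\nu\,x\tilde x:x[y\triangleright S].Q[z,\tilde y\lhd P,\tilde P])(x(y).R\mid\tilde R)\Rightarrow(\nu\,x\tilde x:Q[\tilde y\lhd\tilde P])((\nu\,yz:S)(R\mid P)\mid\tilde R)$, where $z$ is the free name of $S$ other than $y$; - (close) $(\nu\,x\tilde x:x().Q[\tilde y\lhd\tilde P])(x[]\mid\tilde R)\Rightarrow(\nu\,x\tilde x:Q[\tilde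 y\lhd\tilde P])(\tilde R)$; - (wait) $(\nu\,x\tilde x:x[])(x().P)\Rightarrow P$; - (link) $(\nu\,xy:x\leftrightarrow y)(x\leftrightarrow z\mid y\leftrightarrow w)\Rightarrow z\leftrightarrow w$; - (commuting conversions) if a component $R_i$ (owning $x_i$) starts with an action on a name $w\ne x_i$, the multi-composition is pushed under it: writing $M(R_i)$ for the multi-composition with distinguished component $R_i$, $M(w().R)\Rightarrow w().M(R)$, $M(w(v).R)\Rightarrow w(v).M(R)$, $M(w[v\triangleright R'].R)\Rightarrow w[v\triangleright R'].M(R)$ if $x_i$ is free in $R$, and $M(w[v\triangleright R'].R)\Rightarrow w[v\triangleright M(R')].R$ if $x_i$ is free in $R'$. The names in distinct contexts $\Sigma_i$ are disjoint, and disjoint from $\tilde x$. *)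

(* Defs.v *)
From Stdlib Require Export Arith List Permutation Relations.
Export ListNotations.

Definition name := nat.
Definition atom := nat.

(** ** Types *)

Inductive ty : Type :=
| Atom (a : atom)
| NAtom (a : atom)
| One
| Bot
| Tensor (A B : ty)
| Par (A B : ty).

Fixpoint dual (A : ty) : ty :=
  match A with
  | Atom a => NAtom a
  | NAtom a => Atom a
  | One => Bot
  | Bot => One
  | Tensor A B => Par (dual A) (dual B)
  | Par A B => Tensor (dual A) (dual B)
  end.

(** In [AOne us] the list [us] has to be non-empty and duplicate-free.  This is
    imposed by [fw_one], the only rule introducing such a type, so it holds of
    every [AOne] occurring in a derivable forwarder judgement. *)
Inductive aty : Type :=
| AAtom (a : atom)
| ANAtom (a : atom)
| AOne (us : list name)
| ABot (u : name)
| ATensor (u : name) (A : ty) (B : aty)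
| APar (u : name) (A : ty) (B : aty).

Fixpoint erase (B : aty) : ty :=
  match B with
  | AAtom a => Atom a
  | ANAtom a => NAtom a
  | AOne _ => One
  | ABot _ => Bot
  | ATensor _ A B => Tensor A (erase B)
  | APar _ A B => Par A (erase B)
  end.

(** [annot x A] is A(x). *)
Fixpoint annot (x : name) (A : ty) : aty :=
  match A with
  | Atom a => AAtom a
  | NAtom a => ANAtom a
  | One => AOne [x]
  | Bot => ABot x
  | Tensor A B => ATensor x A (annot x B)
  | Par A B => APar x A (annot x B)
  end.

(** ** Processes

    [Out x y P Q] is x[y |> P].Q; its bound name [y] has scope [P] only.

    [Comp xs Q ms cs] is the multi-composition (nu xs : Q[ys <| Ps])(Rs), where
    [ms] lists the messages in transit as pairs (y_j, P_j) and [cs] the composed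
    processes as pairs (x_i, R_i) of an owned endpoint and its owner.  The
    terminated endpoints are the elements of [xs] that own no process.  The
    names [xs] and the [ys] are bound in the whole term. *)
Inductive proc : Type :=
| Link (x y : name)
| Wait (x : name) (P : proc)
| Close (x : name)
| In (x y : name) (P : proc)
| Out (x y : name) (P Q : proc)
| Comp (xs : list name) (Q : proc) (ms cs : list (name * proc)).

(** [In] is now a constructor; list membership is [mem]. *)
Notation mem := List.In.

Definition minus (l bs : list name) : list name :=
  filter (fun v => negb (existsb (Nat.eqb v) bs)) l.

Fixpoint fn (P : proc) : list name :=
  match P with
  | Link x y => [x; y]
  | Wait x P => x :: fn P
  | Close x => [x]
  | In x y P => x :: minus (fn P) [y]
  | Out x y P Q => x :: minus (fn P) [y] ++ fn Q
  | Comp xs Q ms cs =>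
      minus (fn Q ++ flat_map (fun p => fst p :: fn (snd p)) ms
                  ++ flat_map (fun p => fst p :: fn (snd p)) cs)
            (xs ++ map fst ms)
  end.

Definition fns (l : list (name * proc)) : list name :=
  flat_map (fun p => fst p :: fn (snd p)) l.

Definition fresh (v : name) (l : list name) : Prop := ~ mem v l.
Definition disjoint (l l' : list name) : Prop := forall v, mem v l -> ~ mem v l'.

Definition swapn (a b v : name) : name :=
  if v =? a then b else if v =? b then a else v.

(** The transposition of [a] and [b], acting on all names, bound ones
    included. *)
Fixpoint swap (a b : name) (P : proc) : proc :=
  match P with
  | Link x y => Link (swapn a b x) (swapn a b y)
  | Wait x P => Wait (swapn a b x) (swap a b P)
  | Close x => Close (swapn a b x)
  | In x y P => In (swapn a b x) (swapn a b y) (swap a b P)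
  | Out x y P Q =>
      Out (swapn a b x) (swapn a b y) (swap a b P) (swap a b Q)
  | Comp xs Q ms cs =>
      Comp (map (swapn a b) xs) (swap a b Q)
           (map (fun p => (swapn a b (fst p), swap a b (snd p))) ms)
           (map (fun p => (swapn a b (fst p), swap a b (snd p))) cs)
  end.

(** Identity of processes: renaming of bound names (the [_alpha] rules, in the
    nominal style), symmetry of links, and irrelevance of the order in
    multi-compositions.  All judgements below are closed under it. *)
Inductive pequiv : proc -> proc -> Prop :=
| pe_in_alpha x y z P :
    fresh z (fn P) -> pequiv (In x y P) (In x z (swap y z P))
| pe_out_alpha x y z P Q :
    fresh z (fn P) -> pequiv (Out x y P Q) (Out x z (swap y z P) Q)
| pe_comp_alpha a b xs Q ms cs :
    fresh a (fn (Comp xs Q ms cs)) -> fresh b (fn (Comp xs Q ms cs)) ->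
    pequiv (Comp xs Q ms cs) (swap a b (Comp xs Q ms cs))
| pe_link x y : pequiv (Link x y) (Link y x)
| pe_comp_perm xs xs' Q ms ms' cs cs' :
    Permutation xs xs' -> Permutation ms ms' -> Permutation cs cs' ->
    pequiv (Comp xs Q ms cs) (Comp xs' Q ms' cs')
| pe_refl P : pequiv P P
| pe_sym P Q : pequiv P Q -> pequiv Q P
| pe_trans P Q R : pequiv P Q -> pequiv Q R -> pequiv P R
| pe_wait x P P' : pequiv P P' -> pequiv (Wait x P) (Wait x P')
| pe_in x y P P' : pequiv P P' -> pequiv (In x y P) (In x y P')
| pe_out x y P P' Q Q' :
    pequiv P P' -> pequiv Q Q' -> pequiv (Out x y P Q) (Out x y P' Q')
| pe_comp_fwd xs Q Q' ms cs :
    pequiv Q Q' -> pequiv (Comp xs Q ms cs) (Comp xs Q' ms cs)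
| pe_comp_msg xs Q y P P' ms cs :
    pequiv P P' ->
    pequiv (Comp xs Q ((y, P) :: ms) cs) (Comp xs Q ((y, P') :: ms) cs)
| pe_comp_proc xs Q ms x R R' cs :
    pequiv R R' ->
    pequiv (Comp xs Q ms ((x, R) :: cs)) (Comp xs Q ms ((x, R') :: cs)).

(** ** CP (multiplicative, cut-free) *)

Definition ctx := list (name * ty).
Definition names (D : ctx) : list name := map fst D.

(** Rules without a distinctness condition preserve distinctness of the names
    in the context.  There is no rule for [Comp]. *)
Inductive cp : proc -> ctx -> Prop :=
| cp_link x y a :
    x <> y -> cp (Link x y) [(x, NAtom a); (y, Atom a)]
| cp_close x :
    cp (Close x) [(x, One)]
| cp_wait x P D :
    fresh x (names D) -> cp P D -> cp (Wait x P) (D ++ [(x, Bot)])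
| cp_out x y P Q D1 D2 A1 A2 :
    NoDup (names (D1 ++ D2 ++ [(x, Tensor A1 A2)])) ->
    cp P (D1 ++ [(y, A1)]) -> cp Q (D2 ++ [(x, A2)]) ->
    cp (Out x y P Q) (D1 ++ D2 ++ [(x, Tensor A1 A2)])
| cp_in x y P D A1 A2 :
    cp P (D ++ [(y, A1); (x, A2)]) ->
    cp (In x y P) (D ++ [(x, Par A1 A2)])
| cp_perm P D D' : Permutation D D' -> cp P D -> cp P D'
| cp_equiv P P' D : pequiv P P' -> cp P D -> cp P' D.

(** ** Forwarders *)

Inductive box : Type :=
| Star (u : name)
| Msg (u y : name) (A : ty).

Definition label (b : box) : name :=
  match b with Star u => u | Msg u _ _ => u end.

Definition box_names (b : box) : list name :=
  match b with Star _ => [] | Msg _ y _ => [y] end.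

Definition queue := list box.

(** [Ent Psi x (Some B)] is [[Psi]] x:B, and [Ent Psi x None] is the terminated
    endpoint [[Psi]] x:. *)
Inductive entry : Type := Ent (Psi : queue) (x : name) (C : option aty).

Definition fctx := list entry.

Definition entry_names (e : entry) : list name :=
  match e with Ent Psi x _ => x :: flat_map box_names Psi end.

Definition fnames (G : fctx) : list name := flat_map entry_names G.

(** All names of a derivable context, endpoints and queued messages, are
    distinct, and its terminated endpoints have a non-empty queue: both are
    invariants of the rules.  In [fw_tensor], the type (A(y))^bot, whose
    annotations are all [y], is A^bot annotated with [y]. *)
Inductive fwd : proc -> fctx -> Prop :=
| fw_ax x y a :
    x <> y ->
    fwd (Link x y) [Ent [] x (Some (ANAtom a)); Ent [] y (Some (AAtom a))]
| fw_one x us :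
    us <> [] -> NoDup (x :: us) ->
    fwd (Close x)
        (map (fun u => Ent [Star x] u None) us ++ [Ent [] x (Some (AOne us))])
| fw_bot x u P G Psi :
    fwd P (G ++ [Ent (Psi ++ [Star u]) x None]) ->
    fwd (Wait x P) (G ++ [Ent Psi x (Some (ABot u))])
| fw_par x y u P G Psi A B :
    fwd P (G ++ [Ent (Psi ++ [Msg u y A]) x (Some B)]) ->
    fwd (In x y P) (G ++ [Ent Psi x (Some (APar u A B))])
| fw_tensor x y z u P Q G Psiu Psix A B C :
    fresh z (fnames (G ++ [Ent Psiu u C; Ent Psix x (Some B)])) ->
    fwd P [Ent [] z (Some (annot y (dual A))); Ent [] y (Some (annot z A))] ->
    fwd Q (G ++ [Ent Psiu u C; Ent Psix x (Some B)]) ->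
    fwd (Out x y P Q)
        (G ++ [Ent (Msg x z (dual A) :: Psiu) u C;
               Ent Psix x (Some (ATensor u A B))])
| fw_queue P G Psi1 b b' Psi2 x C :
    label b <> label b' ->
    fwd P (G ++ [Ent (Psi1 ++ b :: b' :: Psi2) x C]) ->
    fwd P (G ++ [Ent (Psi1 ++ b' :: b :: Psi2) x C])
| fw_perm P G G' : Permutation G G' -> fwd P G -> fwd P G'
| fw_equiv P P' G : pequiv P P' -> fwd P G -> fwd P' G.

(** ** Reduction

    The freshness and disjointness premises spell out the convention on bound
    names: no name is captured, and no name leaves the scope of its binder.
    Redexes do not occur inside the forwarder of a multi-composition, which is
    therefore not a position in which reduction is closed. *)
Inductive red : proc -> proc -> Prop :=
| red_send x xs y Q ms P R cs :
    fresh y (x :: xs ++ fn R ++ fns ms ++ fns cs) ->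
    red (Comp (x :: xs) (In x y Q) ms ((x, Out x y P R) :: cs))
        (Comp (x :: xs) Q ((y, P) :: ms) ((x, R) :: cs))
| red_receive x xs y z S Q P ms R cs :
    y <> z -> (forall v, mem v (fn S) <-> v = y \/ v = z) ->
    fresh y (x :: fn P) ->
    fresh z (x :: xs ++ fn Q ++ fn R ++ fns ms ++ fns cs) ->
    red (Comp (x :: xs) (Out x y S Q) ((z, P) :: ms) ((x, In x y R) :: cs))
        (Comp (x :: xs) Q ms
              ((x, Comp [y; z] S [] [(y, R); (z, P)]) :: cs))
| red_close x xs Q ms cs :
    red (Comp (x :: xs) (Wait x Q) ms ((x, Close x) :: cs))
        (Comp (x :: xs) Q ms cs)
| red_wait x xs P :
    disjoint (x :: xs) (fn P) ->
    red (Comp (x :: xs) (Close x) [] [(x, Wait x P)]) P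
| red_link x y z w :
    disjoint [x; y] [z; w] ->
    red (Comp [x; y] (Link x y) [] [(x, Link x z); (y, Link y w)]) (Link z w)
| red_comm_wait xs Q ms x w R cs :
    fresh w (x :: xs ++ map fst ms) ->
    red (Comp xs Q ms ((x, Wait w R) :: cs))
        (Wait w (Comp xs Q ms ((x, R) :: cs)))
| red_comm_in xs Q ms x w v R cs :
    fresh w (x :: xs ++ map fst ms) ->
    fresh v (x :: xs ++ fn Q ++ fns ms ++ fns cs) ->
    red (Comp xs Q ms ((x, In w v R) :: cs))
        (In w v (Comp xs Q ms ((x, R) :: cs)))
| red_comm_out_cont xs Q ms x w v R' R cs :
    fresh w (x :: xs ++ map fst ms) ->
    mem x (fn R) ->
    disjoint (minus (fn R') [v]) (xs ++ map fst ms) ->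
    red (Comp xs Q ms ((x, Out w v R' R) :: cs))
        (Out w v R' (Comp xs Q ms ((x, R) :: cs)))
| red_comm_out_spawn xs Q ms x w v R' R cs :
    fresh w (x :: xs ++ map fst ms) ->
    mem x (fn R') ->
    fresh v (x :: xs ++ fn Q ++ fns ms ++ fns cs) ->
    disjoint (fn R) (xs ++ map fst ms) ->
    red (Comp xs Q ms ((x, Out w v R' R) :: cs))
        (Out w v (Comp xs Q ms ((x, R') :: cs)) R)
| red_ctx_wait x P P' : red P P' -> red (Wait x P) (Wait x P')
| red_ctx_in x y P P' : red P P' -> red (In x y P) (In x y P')
| red_ctx_out_spawn x y P P' Q : red P P' -> red (Out x y P Q) (Out x y P' Q)
| red_ctx_out_cont x y P Q Q' : red Q Q' -> red (Out x y P Q) (Out x y P Q')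
| red_ctx_msg xs Q y P P' ms cs :
    red P P' -> red (Comp xs Q ((y, P) :: ms) cs) (Comp xs Q ((y, P') :: ms) cs)
| red_ctx_proc xs Q ms x R R' cs :
    red R R' -> red (Comp xs Q ms ((x, R) :: cs)) (Comp xs Q ms ((x, R') :: cs))
| red_equiv P P' Q Q' : pequiv P P' -> red P' Q' -> pequiv Q' Q -> red P Q.

Definition reds : proc -> proc -> Prop := clos_refl_trans proc red.

(* Main.v *)
Require Import Defs.
From Stdlib Require Import Lia.

(** The forwarder drives the computation.  Its first action is on some endpoint
    [x], and cut-free typing leaves the owner of [x] two options: either it
    performs the dual action on [x], and a principal reduction applies, or it
    starts with an action on another name, and a commuting conversion moves that
    action out of the multi-composition.  Commuting conversions keep all types
    and shrink the owner.  Principal reductions decrease the total size of the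
    types of live endpoints and messages in transit: sending splits
    [A (x) B] into [A] in transit and [B], while receiving [A par B] first
    eliminates the inner composition of [A] against its dual and then continues
    with [B].  Induction is on these two sizes lexicographically; annotations and
    the order of queues play no role. *)

(** * Distinctness of names through multiplicities *)

(** A named function, so that [lia] sees one atom per pair of names and no case split. *)
Definition delta (u v : name) : nat := if Nat.eq_dec u v then 1 else 0.

Definition cnt (l : list name) (v : name) : nat := count_occ Nat.eq_dec l v.

Lemma cnt_nil v : cnt [] v = 0.
Proof. reflexivity. Qed.

Lemma cnt_cons u l v : cnt (u :: l) v = delta u v + cnt l v.
Proof.
  unfold cnt, delta; simpl; destruct (Nat.eq_dec u v); reflexivity.
Qed.

Lemma cnt_app l l' v : cnt (l ++ l') v = cnt l v + cnt l' v.
Proof. apply count_occ_app. Qed.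

Lemma nodup_cnt l : NoDup l <-> forall v, cnt l v <= 1.
Proof. apply (NoDup_count_occ Nat.eq_dec). Qed.

Lemma cnt_perm l l' v : Permutation l l' -> cnt l v = cnt l' v.
Proof. intros H; now apply (Permutation_count_occ Nat.eq_dec). Qed.

Lemma cnt_names D D' v :
  Permutation D D' -> cnt (names D) v = cnt (names D') v.
Proof. intros H; apply cnt_perm, Permutation_map, H. Qed.

Lemma names_nil : names [] = [].
Proof. reflexivity. Qed.

Lemma names_cons v A D : names ((v, A) :: D) = v :: names D.
Proof. reflexivity. Qed.

Lemma names_app D D' : names (D ++ D') = names D ++ names D'.
Proof. apply map_app. Qed.

(* Multiplicities turn distinctness side conditions into linear arithmetic. *)
Ltac nodup :=
  let v := fresh "v" in
  apply nodup_cnt; intro v;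
  repeat match goal with
  | H : NoDup ?l |- _ =>
      let K := fresh in
      pose proof (proj1 (nodup_cnt _) H v) as K; clear H
  | H : @Permutation (name * ty) _ _ |- _ =>
      let K := fresh in pose proof (cnt_names _ _ v H) as K; clear H
  | H : @Permutation name _ _ |- _ =>
      let K := fresh in pose proof (cnt_perm _ _ v H) as K; clear H
  end;
  repeat rewrite ?names_app, ?names_cons, ?names_nil, ?cnt_app, ?cnt_cons,
    ?cnt_nil in *;
  lia.

Lemma fresh_exists (l : list name) : exists v, ~ mem v l.
Proof.
  exists (S (list_max l)); intros H.
  pose proof (proj1 (list_max_le l (list_max l)) (le_n _)) as K.
  rewrite Forall_forall in K; apply K in H; lia.
Qed.

Lemma mem_perm_names D D' v :
  Permutation D D' -> (mem v (names D) <-> mem v (names D')).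
Proof.
  intros H; apply (Permutation_map fst) in H.
  split; apply Permutation_in; [|apply Permutation_sym]; exact H.
Qed.

Lemma mem_minus v l bs : mem v (minus l bs) <-> mem v l /\ ~ mem v bs.
Proof.
  unfold minus; rewrite filter_In, Bool.negb_true_iff.
  split; intros [H K]; split; auto.
  - intros M; rewrite <- Bool.not_true_iff_false in K; apply K.
    apply existsb_exists; exists v; split; [exact M|apply Nat.eqb_refl].
  - apply Bool.not_true_iff_false; intros M; apply existsb_exists in M.
    destruct M as [w [M E]]; apply Nat.eqb_eq in E; subst; auto.
Qed.

(** * Duality, transpositions and permutations of contexts *)

Lemma dual_involutive A : dual (dual A) = A.
Proof. induction A; simpl; congruence. Qed.

Lemma erase_annot x A : erase (annot x A) = A.
Proof. induction A; simpl; congruence. Qed.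

Lemma swapn_inj a b v w : swapn a b v = swapn a b w -> v = w.
Proof.
  unfold swapn; intros H.
  destruct (Nat.eqb_spec v a), (Nat.eqb_spec w a),
    (Nat.eqb_spec v b), (Nat.eqb_spec w b); congruence.
Qed.

Lemma swapn_l a b : swapn a b a = b.
Proof. unfold swapn; now rewrite Nat.eqb_refl. Qed.

Lemma swapn_other a b v : v <> a -> v <> b -> swapn a b v = v.
Proof.
  unfold swapn; intros H K.
  destruct (Nat.eqb_spec v a), (Nat.eqb_spec v b); congruence.
Qed.

Definition swap_ctx a b : ctx -> ctx :=
  map (fun p => (swapn a b (fst p), snd p)).

Lemma names_swap a b D : names (swap_ctx a b D) = map (swapn a b) (names D).
Proof. unfold names, swap_ctx; now rewrite !map_map. Qed.

Lemma swap_ctx_fresh a b D :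
  fresh a (names D) -> fresh b (names D) -> swap_ctx a b D = D.
Proof.
  unfold fresh; induction D as [|[v A] D IH]; simpl; intros Ha Hb; auto.
  rewrite swapn_other, IH; auto.
Qed.

Lemma mem_swap a b v l : mem (swapn a b v) (map (swapn a b) l) <-> mem v l.
Proof.
  rewrite in_map_iff; split.
  - intros [w [H K]]; apply swapn_inj in H; now subst.
  - intros H; now exists v.
Qed.

Lemma nodup_swap a b l : NoDup l -> NoDup (map (swapn a b) l).
Proof.
  apply FinFun.Injective_map_NoDup; intros v w; apply swapn_inj.
Qed.

Lemma swap_ctx_perm a b D D' :
  Permutation D D' -> Permutation (swap_ctx a b D) (swap_ctx a b D').
Proof. apply Permutation_map. Qed.

(** Separates the endpoint being cut from the subject of a foreign action: [D0] is the context
    without both. *)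
Lemma perm_cons_neq x w (T U : ty) (D D' : ctx) :
  x <> w -> Permutation ((x, T) :: D) ((w, U) :: D') ->
  exists D0, Permutation D ((w, U) :: D0) /\ Permutation D' ((x, T) :: D0).
Proof.
  intros N H.
  assert (K : mem (w, U) D).
  { assert (K : mem (w, U) ((x, T) :: D))
      by (apply (Permutation_in _ (Permutation_sym H)); now left).
    destruct K as [K|K]; [congruence|exact K]. }
  apply in_split in K; destruct K as [l1 [l2 ->]].
  exists (l1 ++ l2); split; [symmetry; apply Permutation_middle|].
  apply (Permutation_cons_inv (a := (w, U))).
  rewrite <- H.

  eapply perm_trans; [|apply perm_swap].
  apply perm_skip. symmetry. apply Permutation_middle.
Qed.

Lemma perm_cons_eq x (T U : ty) (D D' : ctx) :
  fresh x (names D') -> Permutation ((x, T) :: D) ((x, U) :: D') ->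
  T = U /\ Permutation D D'.
Proof.
  intros F H.
  assert (K : mem (x, T) ((x, U) :: D'))
    by (apply (Permutation_in _ H); now left).
  destruct K as [K|K].
  - injection K as ->; split; [reflexivity|].
    now apply Permutation_cons_inv in H.
  - exfalso; apply F; exact (in_map fst _ _ K).
Qed.

(** * Invertible typing of cut-free processes *)

(** Cut-free CP without [cp_equiv]; every typable process is identified with one
    typable here ([cp_cpn]), so that derivations can be inverted. *)
Inductive cpn : proc -> ctx -> Prop :=
| cpn_link x y a D :
    x <> y -> Permutation D [(x, NAtom a); (y, Atom a)] -> cpn (Link x y) D
| cpn_close x : cpn (Close x) [(x, One)]
| cpn_wait x P D D' :
    fresh x (names D) -> cpn P D -> Permutation D' ((x, Bot) :: D) ->
    cpn (Wait x P) D'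
| cpn_in x y P D D' A B :
    cpn P ((y, A) :: (x, B) :: D) -> Permutation D' ((x, Par A B) :: D) ->
    cpn (In x y P) D'
| cpn_out x y P Q D1 D2 D' A B :
    NoDup (names D') -> cpn P ((y, A) :: D1) -> cpn Q ((x, B) :: D2) ->
    Permutation D' ((x, Tensor A B) :: D1 ++ D2) ->
    cpn (Out x y P Q) D'.

(** Every rule but [cpn_close] has a [Permutation] premise on its conclusion, so exchange is
    absorbed by the last rule; a singleton context has only one order. *)
Lemma cpn_perm P D D' : Permutation D D' -> cpn P D -> cpn P D'.
Proof.
  intros H K; revert D' H; destruct K; intros E' HE.
  - eapply cpn_link; eauto. rewrite <- HE; eassumption.
  - apply Permutation_length_1_inv in HE; subst; constructor.
  - eapply cpn_wait; eauto. rewrite <- HE; eassumption.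
  - eapply cpn_in; eauto. rewrite <- HE; eassumption.
  - eapply cpn_out; eauto; [|rewrite <- HE; eassumption]. nodup.
Qed.

Lemma cpn_cp P D : cpn P D -> cp P D.
Proof.
  induction 1.
  - eapply cp_perm; [symmetry; eassumption|now constructor].
  - constructor.
  - eapply cp_perm; [|apply cp_wait; eassumption].
    rewrite H1; symmetry; apply Permutation_cons_append.
  - eapply cp_perm; [|apply cp_in].
    + rewrite H0; symmetry; apply Permutation_cons_append.
    + eapply cp_perm; [|exact IHcpn].
      apply (Permutation_app_comm [_; _]).
  - eapply cp_perm; [|apply cp_out with (D1 := D1) (D2 := D2) (A1 := A)].
    + rewrite H2, app_assoc; symmetry; apply Permutation_cons_append.
    + nodup.
    + eapply cp_perm; [|exact IHcpn1]. apply Permutation_cons_append.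
    + eapply cp_perm; [|exact IHcpn2]. apply Permutation_cons_append.
Qed.

(** The existential absorbs [cp_equiv]; the other rules lift the equivalence through their
    constructor by congruence. *)
Lemma cp_cpn P D : cp P D -> exists P', pequiv P P' /\ cpn P' D.
Proof.
  induction 1.
  - exists (Link x y); split; [apply pe_refl|]. now apply cpn_link with a.
  - exists (Close x); split; [apply pe_refl|constructor].
  - destruct IHcp as [P' [E K]]; exists (Wait x P'); split.
    + now apply pe_wait.
    + eapply cpn_wait; eauto. symmetry; apply Permutation_cons_append.
  - destruct IHcp1 as [P' [E K]], IHcp2 as [Q' [E' K']].
    exists (Out x y P' Q'); split; [now apply pe_out|].
    eapply cpn_out with (D1 := D1) (D2 := D2); eauto.
    + eapply cpn_perm; [|exact K]. symmetry; apply Permutation_cons_append.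
    + eapply cpn_perm; [|exact K']. symmetry; apply Permutation_cons_append.
    + rewrite app_assoc; symmetry; apply Permutation_cons_append.
  - destruct IHcp as [P' [E K]]; exists (In x y P'); split.
    + now apply pe_in.
    + eapply cpn_in.
      * eapply cpn_perm; [|exact K]. apply (Permutation_app_comm D [_; _]).
      * symmetry; apply Permutation_cons_append.
  - destruct IHcp as [P' [E K]]; exists P'; split; auto.
    eapply cpn_perm; eauto.
  - destruct IHcp as [P'' [E K]]; exists P''; split; auto.
    eapply pe_trans; [apply pe_sym|]; eassumption.
Qed.

Lemma cpn_nodup P D : cpn P D -> NoDup (names D).
Proof.
  induction 1; auto.
  - assert (N : NoDup [x; y])
      by (repeat constructor; simpl; intuition congruence).
    nodup.
  - repeat constructor; simpl; auto.
  - assert (N : NoDup (x :: names D)) by now constructor.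
    clear H; nodup.
  - nodup.
Qed.

(** Turns the side conditions of [red] on free names into conditions on contexts. In the binding
    cases, distinctness of the premise's names ensures that removing the bound name loses nothing
    else. *)
Lemma cpn_fn P D v : cpn P D -> mem v (fn P) <-> mem v (names D).
Proof.
  induction 1; cbn [fn].
  - rewrite (mem_perm_names _ _ _ H0); simpl; tauto.
  - simpl; tauto.
  - rewrite (mem_perm_names _ _ _ H1); simpl; rewrite IHcpn; tauto.
  - rewrite (mem_perm_names _ _ _ H0); simpl; rewrite mem_minus, IHcpn.
    pose proof (cpn_nodup _ _ H) as N; simpl in N; inversion_clear N.
    simpl in *; intuition (subst; eauto).
  - rewrite (mem_perm_names _ _ _ H2).
    cbn [mem]; rewrite in_app_iff, mem_minus, IHcpn1, IHcpn2.
    pose proof (cpn_nodup _ _ H0) as N; simpl in N; inversion_clear N.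
    simpl; rewrite names_app, in_app_iff; simpl; intuition (subst; eauto).
Qed.

Lemma fresh_swap a b v D :
  fresh v (names D) -> fresh (swapn a b v) (names (swap_ctx a b D)).
Proof. unfold fresh; rewrite names_swap, mem_swap; auto. Qed.

Lemma cpn_swap a b P D : cpn P D -> cpn (swap a b P) (swap_ctx a b D).
Proof.
  induction 1; cbn [swap].
  - apply cpn_link with a0; [now intros E; apply swapn_inj in E|].
    now apply (swap_ctx_perm a b) in H0.
  - constructor.
  - eapply cpn_wait; [|exact IHcpn|]; [now apply fresh_swap|].
    now apply (swap_ctx_perm a b) in H1.
  - eapply cpn_in; [exact IHcpn|]. now apply (swap_ctx_perm a b) in H0.
  - eapply cpn_out; [|exact IHcpn1|exact IHcpn2|].
    + rewrite names_swap; now apply nodup_swap.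
    + apply (swap_ctx_perm a b) in H2; rewrite H2; simpl.
      unfold swap_ctx; now rewrite map_app.
Qed.

(** The transposition acts as a renaming because neither name occurs in [D]: [w] by hypothesis, [v]
    by distinctness. *)
Lemma cpn_rename v w P A D :
  fresh w (names D) -> cpn P ((v, A) :: D) ->
  cpn (swap v w P) ((w, A) :: D).
Proof.
  intros F H; pose proof (cpn_nodup _ _ H) as N; inversion_clear N.
  apply (cpn_swap v w) in H; simpl in H.
  now rewrite swapn_l, swap_ctx_fresh in H.
Qed.

(** * Size and first action of a process *)

Fixpoint psize (P : proc) : nat :=
  match P with
  | Wait _ P | In _ _ P => S (psize P)
  | Out _ _ P Q => S (psize P + psize Q)
  | _ => 0
  end.

Lemma psize_swap a b P : psize (swap a b P) = psize P.
Proof. induction P; simpl; auto. Qed.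

(** Defined only on the prefixes that a commuting conversion can push outwards. *)
Definition subject (P : proc) : option name :=
  match P with
  | Wait w _ | In w _ _ | Out w _ _ _ => Some w
  | _ => None
  end.

(** Inversion of typing at a chosen endpoint [x]: a foreign first action, or the action dictated by
    the type. Links appear up to [pequiv], since [x] may be either end. *)
Inductive view (x : name) : ty -> proc -> ctx -> Prop :=
| view_comm T R D w : subject R = Some w -> w <> x -> view x T R D
| view_atom a z R :
    pequiv R (Link x z) -> view x (Atom a) R [(z, NAtom a)]
| view_natom a z R :
    pequiv R (Link x z) -> view x (NAtom a) R [(z, Atom a)]
| view_one : view x One (Close x) []
| view_bot R D : cpn R D -> view x Bot (Wait x R) D
| view_par y R A B D :
    cpn R ((y, A) :: (x, B) :: D) -> view x (Par A B) (In x y R) D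
| view_tensor y P R A B D1 D2 D :
    cpn P ((y, A) :: D1) -> cpn R ((x, B) :: D2) ->
    Permutation D (D1 ++ D2) -> view x (Tensor A B) (Out x y P R) D.

Lemma cpn_view x T R D : cpn R ((x, T) :: D) -> view x T R D.
Proof.
  intros H; pose proof (cpn_nodup _ _ H) as N; inversion H; subst.
  - destruct (Nat.eq_dec x x0) as [<-|N1].
    + apply perm_cons_eq in H1; [|unfold fresh; simpl; intuition congruence].
      destruct H1 as [-> H1].
      apply Permutation_sym, Permutation_length_1_inv in H1; subst.
      constructor; apply pe_refl.
    + apply perm_cons_neq in H1; auto; destruct H1 as [D0 [K1 K2]].
      apply Permutation_length_1_inv in K2; injection K2 as -> -> ->.
      apply Permutation_sym, Permutation_length_1_inv in K1; subst.
      constructor; apply pe_link.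
  - constructor.
  - destruct (Nat.eq_dec x0 x) as [->|N1].
    + apply perm_cons_eq in H2; auto; destruct H2 as [-> K].
      constructor; eapply cpn_perm; [symmetry|]; eassumption.
    + eapply view_comm; simpl; eauto.
  - destruct (Nat.eq_dec x0 x) as [->|N1].
    + apply perm_cons_eq in H1.
      * destruct H1 as [-> K]; apply view_par.
        eapply cpn_perm; [|exact H0].
        do 2 apply perm_skip; now symmetry.
      * apply cpn_nodup in H0; inversion_clear H0; now inversion H3.
    + eapply view_comm; simpl; eauto.
  - destruct (Nat.eq_dec x0 x) as [->|N1].
    + apply perm_cons_eq in H3.
      * destruct H3 as [-> K]; eapply view_tensor; eauto.
      * assert (N2 : NoDup (x :: names (D1 ++ D2))) by nodup.
        now inversion N2.
    + eapply view_comm; simpl; eauto.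
Qed.

(** * Forwarders up to annotations and queue order *)

(** Forwarders without annotations, queue order and [fw_equiv].  In
    [fwn Q X E M], [X] lists all endpoints, including the terminated ones, [E]
    the live endpoints and [M] the messages in the queues.  The types are those
    of the processes owning these names, hence dual to those in [fwd]. *)
Inductive fwn : proc -> list name -> ctx -> ctx -> Prop :=
| fwn_ax x y a X E :
    x <> y -> Permutation X [x; y] ->
    Permutation E [(x, Atom a); (y, NAtom a)] -> fwn (Link x y) X E []
| fwn_one x X : NoDup X -> mem x X -> fwn (Close x) X [(x, Bot)] []
| fwn_bot x P X E E' M :
    mem x X -> fresh x (names E) -> fwn P X E M ->
    Permutation E' ((x, One) :: E) -> fwn (Wait x P) X E' M
| fwn_par x y P X E E' M A B :
    fwn P X ((x, B) :: E) ((y, A) :: M) ->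
    Permutation E' ((x, Tensor A B) :: E) -> fwn (In x y P) X E' M
| fwn_tensor x y z P Q X E E' M M' A B :
    fresh z (X ++ names M) ->
    fwn P [z; y] [(z, dual A); (y, A)] [] -> fwn Q X ((x, B) :: E) M ->
    Permutation E' ((x, Par A B) :: E) ->
    Permutation M' ((z, dual A) :: M) ->
    fwn (Out x y P Q) X E' M'.

Lemma fwn_perm P X X' E E' M M' :
  fwn P X E M -> Permutation X X' -> Permutation E E' -> Permutation M M' ->
  fwn P X' E' M'.
Proof.
  intros H; revert X' E' M'; induction H; intros X' E1 M1 HX HE HM.
  - apply Permutation_nil in HM; subst.
    apply fwn_ax with a; auto; [rewrite <- HX|rewrite <- HE]; auto.
  - apply Permutation_nil in HM; subst.
    apply Permutation_length_1_inv in HE; subst; constructor.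
    + now apply (Permutation_NoDup HX).
    + now apply (Permutation_in _ HX).
  - eapply fwn_bot; eauto; [now apply (Permutation_in _ HX)|].
    rewrite <- HE; eassumption.
  - eapply fwn_par; [apply IHfwn|]; auto. rewrite <- HE; eassumption.
  - eapply fwn_tensor; eauto.
    + intros K; apply H.
      rewrite in_app_iff in *; destruct K as [K|K]; auto.
      left; now apply (Permutation_in _ (Permutation_sym HX)).
    + rewrite <- HE; eassumption.
    + rewrite <- HM; eassumption.
Qed.

(** Only [fwn_tensor] adds a name to the queues, and its freshness premise keeps that name apart
    from the endpoints and the other messages. *)
Lemma fwn_inv P X E M :
  fwn P X E M ->
  NoDup (X ++ names M) /\ NoDup (names E) /\ incl (names E) X.
Proof.
  induction 1.
  - assert (N : NoDup [x; y])
      by (repeat constructor; simpl; intuition congruence).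
    repeat split; [nodup|nodup|].
    intros v K; rewrite (mem_perm_names _ _ _ H1) in K; simpl in K.
    now apply (Permutation_in _ (Permutation_sym H0)).
  - repeat split.
    + now rewrite app_nil_r.
    + repeat constructor; simpl; auto.
    + intros v [<-|[]]; auto.
  - destruct IHfwn as [N1 [N2 I]]; repeat split; auto.
    + assert (N : NoDup (x :: names E)) by now constructor.
      nodup.
    + intros v K; rewrite (mem_perm_names _ _ _ H2) in K.
      destruct K as [<-|K]; auto.
  - destruct IHfwn as [N1 [N2 I]]; repeat split; [nodup|nodup|].
    intros v K; rewrite (mem_perm_names _ _ _ H0) in K; auto.
  - destruct IHfwn2 as [N1 [N2 I]]; repeat split.
    + assert (N : NoDup (z :: X ++ names M)) by now constructor.
      nodup.
    + nodup.
    + intros v K; rewrite (mem_perm_names _ _ _ H2) in K; auto.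
Qed.

(** Terminated endpoints are listed in [X] but no longer occur in the forwarder. *)
Lemma fwn_fn P X E M v :
  fwn P X E M -> mem v (fn P) <-> mem v (names E) \/ mem v (names M).
Proof.
  induction 1; cbn [fn].
  - rewrite (mem_perm_names _ _ _ H1); simpl; tauto.
  - simpl; tauto.
  - rewrite (mem_perm_names _ _ _ H2); simpl; rewrite IHfwn; tauto.
  - rewrite (mem_perm_names _ _ _ H0); cbn [mem].
    rewrite mem_minus, IHfwn.
    (* The bound [y] names a message, so it lies outside [X] and differs from every live
       endpoint. *)
    destruct (fwn_inv _ _ _ _ H) as [N [_ I]].
    apply Permutation_NoDup with (l' := y :: X ++ names M) in N;
      [|symmetry; apply Permutation_middle].
    inversion_clear N. rewrite in_app_iff in H1.
    pose proof (fun K => H1 (or_introl (I y K))) as F.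
    simpl in *; intuition (subst; eauto).
  - rewrite (mem_perm_names _ _ _ H2), (mem_perm_names _ _ _ H3); cbn [mem].
    rewrite in_app_iff, mem_minus, IHfwn1, IHfwn2.
    destruct (fwn_inv _ _ _ _ H0) as [_ [N _]]; inversion_clear N.
    simpl in *; intuition (subst; eauto).
Qed.

Lemma fwn_swap a b P X E M :
  fwn P X E M ->
  fwn (swap a b P) (map (swapn a b) X) (swap_ctx a b E) (swap_ctx a b M).
Proof.
  induction 1; cbn [swap].
  - apply fwn_ax with a0; [now intros K; apply swapn_inj in K| |].
    + now apply (Permutation_map (swapn a b)) in H0.
    + now apply (swap_ctx_perm a b) in H1.
  - constructor; [now apply nodup_swap|now apply mem_swap].
  - eapply fwn_bot; [|apply fresh_swap; eassumption|exact IHfwn|].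
    + now apply mem_swap.
    + now apply (swap_ctx_perm a b) in H2.
  - eapply fwn_par; [exact IHfwn|]. now apply (swap_ctx_perm a b) in H0.
  - eapply fwn_tensor; [|exact IHfwn1|exact IHfwn2| |].
    + unfold fresh; rewrite names_swap, <- map_app, mem_swap; exact H.
    + now apply (swap_ctx_perm a b) in H2.
    + now apply (swap_ctx_perm a b) in H3.
Qed.

(** * From annotated to plain forwarders *)

Definition ends (G : fctx) : list name :=
  map (fun e => match e with Ent _ x _ => x end) G.

Definition live (G : fctx) : ctx :=
  flat_map (fun e => match e with
    | Ent _ x (Some B) => [(x, dual (erase B))]
    | Ent _ _ None => []
    end) G.

Definition boxed (Psi : queue) : ctx :=
  flat_map (fun b => match b with
    | Star _ => []
    | Msg _ y A => [(y, dual A)]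
    end) Psi.

Definition transit (G : fctx) : ctx :=
  flat_map (fun e => match e with Ent Psi _ _ => boxed Psi end) G.

Lemma live_ends G : incl (names (live G)) (ends G).
Proof.
  intros v; induction G as [|[Psi x [B|]] G IH]; simpl; tauto.
Qed.

Lemma boxed_names Psi : names (boxed Psi) = flat_map box_names Psi.
Proof. induction Psi as [|[]]; simpl; congruence. Qed.

Lemma fnames_ends_transit G v :
  mem v (ends G ++ names (transit G)) -> mem v (fnames G).
Proof.
  rewrite in_app_iff; induction G as [|[Psi x C] G IH]; simpl; [tauto|].
  rewrite names_app, boxed_names, !in_app_iff; tauto.
Qed.

Ltac fwd_simpl :=
  unfold ends, live, transit, boxed;
  rewrite ?map_app, ?flat_map_app; cbn [map flat_map app];
  rewrite ?flat_map_app; cbn [map flat_map app]; rewrite ?app_nil_r.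

(** Without labels, [fw_queue] becomes a permutation of the messages, and the two annotated types of
    the auxiliary forwarder in [fw_tensor] erase to plain duals. *)
Lemma fwd_fwn P G :
  fwd P G ->
  exists P', pequiv P P' /\ fwn P' (ends G) (live G) (transit G).
Proof.
  induction 1.
  - exists (Link x y); split; [apply pe_refl|].
    now apply fwn_ax with a.
  - exists (Close x); split; [apply pe_refl|].
    (* The terminated endpoints contribute to [X] only: they have no type, and a star carries no
       message. *)
    assert (E1 : ends (map (fun u => Ent [Star x] u None) us) = us).
    { unfold ends; rewrite map_map; apply map_id. }
    assert (E2 : live (map (fun u => Ent [Star x] u None) us) = []).
    { clear; induction us; simpl; auto. }
    assert (E3 : transit (map (fun u => Ent [Star x] u None) us) = []).
    { clear; induction us; simpl; auto. }
    unfold ends, live, transit in *.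
    rewrite map_app, !flat_map_app, E1, E2, E3; simpl; constructor.
    + nodup.
    + rewrite in_app_iff; simpl; auto.
  - destruct IHfwd as [P' [E K]]; exists (Wait x P').
    split; [now apply pe_wait|].
    destruct (fwn_inv _ _ _ _ K) as [N _].
    revert K N; fwd_simpl; intros K N.
    apply fwn_bot with (E := live G).
    + rewrite in_app_iff; simpl; auto.
    + intros F; apply live_ends in F.
      assert (N1 : NoDup (x :: ends G)) by (unfold ends; nodup).
      now inversion N1.
    + exact K.
    + symmetry; apply Permutation_cons_append.
  - destruct IHfwd as [P' [E K]]; exists (In x y P').
    split; [now apply pe_in|].
    revert K; fwd_simpl; intros K.
    eapply fwn_par with (A := dual A) (E := live G).
    + eapply fwn_perm; [exact K|auto| |].
      * symmetry; apply Permutation_cons_append.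
      * rewrite !app_assoc; symmetry; apply Permutation_cons_append.
    + symmetry; apply Permutation_cons_append.
  - destruct IHfwd1 as [P' [E1 K1]], IHfwd2 as [Q' [E2 K2]].
    exists (Out x y P' Q'); split; [now apply pe_out|].
    assert (EX : ends (G ++ [Ent Psiu u C; Ent Psix x (Some B)])
              = ends (G ++ [Ent (Msg x z (dual A) :: Psiu) u C;
                            Ent Psix x (Some (ATensor u A B))]))
      by (unfold ends; now rewrite !map_app).
    rewrite <- EX.
    (* [fwn] records the owners' types, hence the instance at [dual A]. *)
    eapply fwn_tensor with (z := z) (A := dual A) (B := dual (erase B))
      (E := live (G ++ [Ent Psiu u C])).
    + intros F; apply H, fnames_ends_transit, F.
    + simpl in K1; now rewrite !erase_annot in K1.
    + eapply fwn_perm; [exact K2|auto| |auto].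
      fwd_simpl; rewrite app_assoc.
      symmetry; apply Permutation_cons_append.
    + fwd_simpl; rewrite app_assoc.
      symmetry; apply Permutation_cons_append.
    + fwd_simpl. symmetry; apply Permutation_middle.
  - destruct IHfwd as [P' [E K]]; exists P'; split; auto.
    eapply fwn_perm; [exact K| | |].
    + unfold ends; now rewrite !map_app.
    + unfold live; now rewrite !flat_map_app.
    + fwd_simpl.
      do 2 apply Permutation_app_head.
      destruct b, b'; simpl; auto. apply perm_swap.
  - destruct IHfwd as [P' [E K]]; exists P'; split; auto.
    eapply fwn_perm; [exact K| | |].
    + now apply Permutation_map.
    + now apply Permutation_flat_map.
    + now apply Permutation_flat_map.
  - destruct IHfwd as [P'' [E K]]; exists P''; split; auto.
    eapply pe_trans; [apply pe_sym|]; eassumption.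
Qed.

(** Neither [y] nor [y'] occurs in [X] or [M], nor in [E], whose names lie in [X]; the transposition
    therefore fixes all three. *)
Lemma fwn_rename y y' P X E A M :
  fwn P X E ((y, A) :: M) -> fresh y' (X ++ names M) ->
  fwn (swap y y' P) X E ((y', A) :: M).
Proof.
  intros H F; destruct (fwn_inv _ _ _ _ H) as [N [_ I]].
  assert (N1 : NoDup (y :: X ++ names M)) by nodup.
  inversion_clear N1 as [|? ? F1 _].
  unfold fresh in F; rewrite in_app_iff in F, F1.
  apply (fwn_swap y y') in H; simpl in H.
  rewrite swapn_l, !swap_ctx_fresh in H;
    try (intros K; try apply I in K; tauto).
  replace X with (map (swapn y y') X); auto.
  rewrite <- (map_id X) at 2; apply map_ext_in.
  intros v K; apply swapn_other; intros ->; tauto.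
Qed.

Lemma fwn_rename_pair y y' z P A B :
  fwn P [z; y] [(z, B); (y, A)] [] -> y' <> z ->
  fwn (swap y y' P) [z; y'] [(z, B); (y', A)] [].
Proof.
  intros H F; destruct (fwn_inv _ _ _ _ H) as [N _].
  inversion_clear N as [|? ? F1 _]; simpl in F1.
  apply (fwn_swap y y') in H; simpl in H.
  now rewrite swapn_l, swapn_other in H by intuition.
Qed.

(** * Normalisation and its closure properties *)

Definition normalizes (P : proc) (D : ctx) : Prop :=
  exists S, reds P S /\ cp S D.

Lemma normalizes_perm P D D' : Permutation D D' -> normalizes P D -> normalizes P D'.
Proof.
  intros H [S [K1 K2]]; exists S; split; auto. eapply cp_perm; eauto.
Qed.

Lemma normalizes_step P P' D : red P P' -> normalizes P' D -> normalizes P D.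
Proof.
  intros H [S [K1 K2]]; exists S; split; auto.
  eapply rt_trans; [apply rt_step|]; eassumption.
Qed.

Lemma normalizes_steps P P' D : reds P P' -> normalizes P' D -> normalizes P D.
Proof.
  intros H [S [K1 K2]]; exists S; split; auto. eapply rt_trans; eassumption.
Qed.

(** The first reduction step absorbs the equivalence through [red_equiv]; an empty reduction has no
    such step, and there [cp_equiv] retypes [P] itself. *)
Lemma normalizes_equiv P P' D : pequiv P P' -> normalizes P' D -> normalizes P D.
Proof.
  intros E [S [K1 K2]]; apply clos_rt_rt1n in K1; destruct K1 as [|P1 S K K1].
  - exists P; split; [apply rt_refl|].
    eapply cp_equiv; [apply pe_sym|]; eassumption.
  - exists S; split; auto.
    eapply rt_trans; [apply rt_step|apply clos_rt1n_rt; eassumption].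
    eapply red_equiv; [exact E|exact K|apply pe_refl].
Qed.

Lemma reds_map (f : proc -> proc) P P' :
  (forall P P', red P P' -> red (f P) (f P')) ->
  reds P P' -> reds (f P) (f P').
Proof.
  intros H K; induction K.
  - now apply rt_step, H.
  - apply rt_refl.
  - eapply rt_trans; eassumption.
Qed.

Lemma normalizes_wait w P D :
  fresh w (names D) -> normalizes P D -> normalizes (Wait w P) ((w, Bot) :: D).
Proof.
  intros F [S [K1 K2]]; exists (Wait w S); split.
  - apply reds_map with (f := Wait w); auto using red_ctx_wait.
  - eapply cp_perm; [|apply cp_wait; eassumption].
    symmetry; apply Permutation_cons_append.
Qed.

Lemma normalizes_in w v P A B D :
  normalizes P ((v, A) :: (w, B) :: D) -> normalizes (In w v P) ((w, Par A B) :: D).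
Proof.
  intros [S [K1 K2]]; exists (In w v S); split.
  - apply reds_map with (f := In w v); auto using red_ctx_in.
  - eapply cp_perm; [|apply cp_in with (D := D)].
    + symmetry; apply Permutation_cons_append.
    + eapply cp_perm; [|exact K2]. apply (Permutation_app_comm [_; _]).
Qed.

Lemma normalizes_out w v P Q A B D1 D2 :
  NoDup (w :: names (D1 ++ D2)) ->
  normalizes P ((v, A) :: D1) -> normalizes Q ((w, B) :: D2) ->
  normalizes (Out w v P Q) ((w, Tensor A B) :: D1 ++ D2).
Proof.
  intros N [S [K1 K2]] [S' [K1' K2']]; exists (Out w v S S'); split.
  - eapply rt_trans with (y := Out w v S Q).
    + apply reds_map with (f := fun P => Out w v P Q);
        auto using red_ctx_out_spawn.
    + apply reds_map with (f := Out w v S); auto using red_ctx_out_cont.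
  - eapply cp_perm; [|apply cp_out with (D1 := D1) (D2 := D2) (A1 := A)].
    + rewrite app_assoc; symmetry; apply Permutation_cons_append.
    + nodup.
    + eapply cp_perm; [|exact K2]. apply Permutation_cons_append.
    + eapply cp_perm; [|exact K2']. apply Permutation_cons_append.
Qed.

Lemma normalizes_cpn P D : cpn P D -> normalizes P D.
Proof. exists P; split; [apply rt_refl|now apply cpn_cp]. Qed.

(** * Commuting conversions *)

(** The part of [R] that owns [x] after its first action is smaller and keeps the type [T], but its
    other free names change; hence the quantification over [D']. In the application, [W] collects
    the contexts of all other components and messages. *)
Lemma normalizes_commute X Q x T R D cs ms W w :
  cpn R ((x, T) :: D) -> mem x X ->
  NoDup (X ++ map fst ms ++ names (D ++ W)) ->
  subject R = Some w -> w <> x ->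
  (forall R' D', psize R' < psize R -> cpn R' ((x, T) :: D') ->
     NoDup (X ++ map fst ms ++ names (D' ++ W)) ->
     normalizes (Comp X Q ms ((x, R') :: cs)) (D' ++ W)) ->
  normalizes (Comp X Q ms ((x, R) :: cs)) (D ++ W).
Proof.
  intros H HX N HS Hw IH.
  (* The subject [w] is typed in [D], so neither [X] nor the messages bind it. *)
  assert (Fw : mem w (names D) -> fresh w (x :: X ++ map fst ms)).
  { intros K F; apply in_split in K; destruct K as [l1 [l2 K]].
    assert (N1 : NoDup (w :: X ++ map fst ms))
      by (rewrite names_app, K in N; nodup).
    inversion_clear N1 as [|? ? K1 _]; apply K1.
    destruct F as [<-|F]; [congruence|exact F]. }
  assert (FD : forall v, mem v (names D) -> ~ mem v (X ++ map fst ms)).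
  { intros v K F; apply in_split in K; destruct K as [l1 [l2 K]].
    assert (N1 : NoDup (v :: X ++ map fst ms))
      by (rewrite names_app, K in N; nodup).
    now inversion_clear N1. }
  assert (FV : forall v, exists v', v' <> v
    /\ NoDup (v' :: X ++ map fst ms ++ names (D ++ W))
    /\ fresh v' (x :: X ++ fn Q ++ fns ms ++ fns cs)
    /\ fresh v' (names ((x, T) :: D))).
  { intros v; destruct (fresh_exists (v :: (x :: X ++ fn Q ++ fns ms ++ fns cs)
      ++ map fst ms ++ names (D ++ W))) as [v' Fv].
    exists v'; unfold fresh; rewrite names_app, NoDup_cons_iff in *; simpl in *.
    repeat rewrite ?in_app_iff in *; simpl in *; intuition. }
  pose proof (cpn_nodup _ _ H) as ND.
  inversion H; subst; try discriminate HS; simpl in HS; injection HS as ->.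
  - apply perm_cons_neq in H2; auto; destruct H2 as [E0 [K1 K2]].
    eapply normalizes_step; [apply red_comm_wait|].
    { apply Fw; rewrite (mem_perm_names _ _ _ K1); now left. }
    eapply normalizes_perm with (D := (w, Bot) :: E0 ++ W); [now rewrite K1|].
    apply normalizes_wait.
    + assert (N1 : NoDup (w :: names (E0 ++ W))) by nodup.
      now inversion N1.
    + apply IH; [simpl; lia|eapply cpn_perm; eassumption|nodup].
  - destruct (FV y) as [v' [Fy [Nv [Fv1 Fv2]]]].
    unfold fresh in Fv2; rewrite (mem_perm_names _ _ _ H1) in Fv2.
    apply perm_cons_neq in H1; auto; destruct H1 as [E0 [K1 K2]].
    eapply normalizes_equiv; [apply pe_comp_proc, pe_in_alpha with (z := v')|].
    { unfold fresh; rewrite (cpn_fn _ _ _ H0); simpl in *; intuition. }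
    apply (cpn_rename _ v') in H0; [|exact Fv2].
    eapply normalizes_step; [apply red_comm_in; auto|].
    { apply Fw; rewrite (mem_perm_names _ _ _ K1); now left. }
    eapply normalizes_perm with (D := (w, Par A B) :: E0 ++ W); [now rewrite K1|].
    apply normalizes_in, (IH _ ((v', A) :: (w, B) :: E0)).
    + simpl; rewrite psize_swap; lia.
    + eapply cpn_perm; [|exact H0].
      rewrite K2. symmetry; apply (Permutation_middle [_; _]).
    + nodup.
  - destruct (FV y) as [v' [Fy [Nv [Fv1 Fv2]]]].
    rename H1 into HP, H2 into HQ, H3 into HE.
    assert (Fv3 : fresh v' (names (D1 ++ D2))).
    { unfold fresh in *; rewrite (mem_perm_names _ _ _ HE) in Fv2.
      simpl in Fv2; tauto. }
    unfold fresh in Fv3; rewrite names_app, in_app_iff in Fv3.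
    apply perm_cons_neq in HE; auto; destruct HE as [E0 [K1 K2]].
    assert (Fw1 : fresh w (x :: X ++ map fst ms)).
    { apply Fw; rewrite (mem_perm_names _ _ _ K1); now left. }
    assert (Nx : NoDup (w :: x :: names E0)) by nodup.
    assert (FE : forall v, mem v (names E0) -> ~ mem v (X ++ map fst ms)).
    { intros v K; apply FD; rewrite (mem_perm_names _ _ _ K1); now right. }
    assert (Fx : fresh x (names E0)).
    { inversion_clear Nx as [|? ? _ Nx1]; now inversion Nx1. }
    (* The side of the output that uses [x] selects the commuting conversion. *)
    assert (Kx : mem x (names D1) \/ mem x (names D2)).
    { rewrite <- in_app_iff, <- names_app, (mem_perm_names _ _ _ K2).
      now left. }
    destruct Kx as [Kx|Kx]; apply in_map_iff in Kx;
      destruct Kx as [[x1 T1] [Kx Kx1]]; simpl in Kx; subst x1;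
      apply in_split in Kx1; destruct Kx1 as [l1 [l2 ->]].
    + rewrite <- Permutation_middle in K2; apply perm_cons_eq in K2; auto.
      destruct K2 as [-> K2]; change (Permutation ((l1 ++ l2) ++ D2) E0) in K2.
      eapply normalizes_equiv; [apply pe_comp_proc, pe_out_alpha with (z := v')|].
      { unfold fresh; rewrite (cpn_fn _ _ _ HP); simpl in *; intuition. }
      apply (cpn_rename _ v') in HP; [|tauto].
      eapply normalizes_step; [apply red_comm_out_spawn; auto|].
      { rewrite (cpn_fn _ _ _ HP); simpl.
        rewrite names_app, in_app_iff; simpl; tauto. }
      (* The continuation leaves the scope of the composition: its free names are [w] and names of
         [E0], none of which is bound there. *)
      { intros v K; rewrite (cpn_fn _ _ _ HQ) in K; destruct K as [<-|K].
        - intros F; apply Fw1; now right.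
        - apply FE; rewrite <- (mem_perm_names _ _ _ K2).
          rewrite names_app, in_app_iff; tauto. }
      eapply normalizes_perm with (D := (w, Tensor A B) :: ((l1 ++ l2) ++ W) ++ D2).
      { rewrite K1, <- K2; simpl; apply perm_skip.
        rewrite <- !app_assoc; do 2 apply Permutation_app_head.
        apply Permutation_app_comm. }
      apply normalizes_out.
      * nodup.
      * apply (IH _ ((v', A) :: l1 ++ l2)).
        -- simpl; rewrite psize_swap; lia.
        -- eapply cpn_perm; [|exact HP].
           symmetry; apply (Permutation_middle ((v', A) :: l1)).
        -- nodup.
      * now apply normalizes_cpn.
    + rewrite app_assoc, <- Permutation_middle in K2.
      apply perm_cons_eq in K2; auto; destruct K2 as [-> K2].
      eapply normalizes_step; [apply red_comm_out_cont; auto|].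
      { rewrite (cpn_fn _ _ _ HQ); simpl.
        rewrite names_app, in_app_iff; simpl; tauto. }
      { intros v K; rewrite mem_minus, (cpn_fn _ _ _ HP) in K; simpl in K.
        apply FE; rewrite <- (mem_perm_names _ _ _ K2), !names_app, !in_app_iff.
        tauto. }
      eapply normalizes_perm with (D := (w, Tensor A B) :: D1 ++ (l1 ++ l2) ++ W).
      { rewrite K1, <- K2; simpl; now rewrite <- !app_assoc. }
      apply normalizes_out.
      * nodup.
      * now apply normalizes_cpn.
      * apply (IH _ ((w, B) :: l1 ++ l2)).
        -- simpl; lia.
        -- eapply cpn_perm; [|exact HQ].
           symmetry; apply (Permutation_middle ((w, B) :: l1)).
        -- nodup.
Qed.

(** * Typed multi-compositions and their measure *)

(** The process [pr] owns the endpoint [ep] of type [cty], and its other free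
    names are typed by [sg]; used for composed processes and messages alike. *)
Record comp := Owner { ep : name; cty : ty; pr : proc; sg : ctx }.

Definition key (c : comp) : name * ty := (ep c, cty c).
Definition own (c : comp) : name * proc := (ep c, pr c).
Definition typed (c : comp) : Prop := cpn (pr c) (key c :: sg c).

Lemma names_key l : names (map key l) = map ep l.
Proof. unfold names; now rewrite map_map. Qed.

Lemma fst_own l : map fst (map own l) = map ep l.
Proof. now rewrite map_map. Qed.

(** The invariant of reduction. It extends the initial hypotheses to messages in transit and to
    closed endpoints, which remain in [X]. *)
Definition ready (Q : proc) (X : list name) (es ms : list comp) : Prop :=
  fwn Q X (map key es) (map key ms) /\ Forall typed es /\ Forall typed ms /\
  NoDup (X ++ map ep ms ++ names (flat_map sg es ++ flat_map sg ms)).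

Definition cut (Q : proc) (X : list name) (es ms : list comp) : Prop :=
  normalizes (Comp X Q (map own ms) (map own es))
    (flat_map sg es ++ flat_map sg ms).

Lemma cut_perm Q X X' es es' ms ms' :
  Permutation X X' -> Permutation es es' -> Permutation ms ms' ->
  cut Q X' es' ms' -> cut Q X es ms.
Proof.
  intros H1 H2 H3 H; unfold cut in *.
  eapply normalizes_perm; [symmetry; apply Permutation_app;
    apply Permutation_flat_map; eassumption|].
  eapply normalizes_equiv; [apply pe_comp_perm|exact H]; auto using Permutation_map.
Qed.

Lemma ready_perm Q X X' es es' ms ms' :
  Permutation X X' -> Permutation es es' -> Permutation ms ms' ->
  ready Q X es ms -> ready Q X' es' ms'.
Proof.
  intros H1 H2 H3 [K1 [K2 [K3 K4]]]; repeat split.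
  - eapply fwn_perm; eauto using Permutation_map.
  - now apply (Permutation_Forall H2).
  - now apply (Permutation_Forall H3).
  - pose proof (Permutation_map ep H3).
    pose proof (Permutation_flat_map sg H2).
    pose proof (Permutation_flat_map sg H3).
    nodup.
Qed.

(** Units count 1, so that [red_close] lowers the weight; a connective counts 1 itself, so that
    splitting it is strict. *)
Fixpoint tsize (A : ty) : nat :=
  match A with
  | Tensor A B | Par A B => S (tsize A + tsize B)
  | _ => 1
  end.

Lemma tsize_dual A : tsize (dual A) = tsize A.
Proof. induction A; simpl; congruence. Qed.

Definition weight (l : list comp) : nat :=
  list_sum (map (fun c => tsize (cty c)) l).

(** Second component of the measure, taken of the composed processes only: messages in transit do
    not act. *)
Definition bulk (l : list comp) : nat :=
  list_sum (map (fun c => psize (pr c)) l).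

Lemma weight_perm l l' : Permutation l l' -> weight l = weight l'.
Proof. intros H; now apply Permutation_list_sum, Permutation_map. Qed.

Lemma bulk_perm l l' : Permutation l l' -> bulk l = bulk l'.
Proof. intros H; now apply Permutation_list_sum, Permutation_map. Qed.

Lemma weight_cons x T R D l :
  weight (Owner x T R D :: l) = tsize T + weight l.
Proof. reflexivity. Qed.

Lemma bulk_cons x T R D l : bulk (Owner x T R D :: l) = psize R + bulk l.
Proof. reflexivity. Qed.

Lemma fns_own l v :
  Forall typed l -> mem v (fns (map own l)) ->
  mem v (map ep l) \/ mem v (names (flat_map sg l)).
Proof.
  unfold fns; induction 1 as [|c l H _ IH]; simpl; auto.
  rewrite in_app_iff, names_app, in_app_iff, (cpn_fn _ _ _ H); simpl; tauto.
Qed.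

(** Finds the component that owns the endpoint or message named by the forwarder's first action. *)
Lemma pick_key l x T E :
  Permutation (map key l) ((x, T) :: E) ->
  exists R D l', Permutation l (Owner x T R D :: l') /\ Permutation E (map key l').
Proof.
  intros H; apply Permutation_sym, Permutation_map_inv in H.
  destruct H as [[|[y U R D] l'] [K1 K2]]; simpl in K1; [discriminate|].
  injection K1 as -> -> ->; exists R, D, l'; auto.
Qed.

Lemma cut_commute Q X x T R D es ms w :
  ready Q X (Owner x T R D :: es) ms -> subject R = Some w -> w <> x ->
  (forall R' D', psize R' < psize R ->
     ready Q X (Owner x T R' D' :: es) ms ->
     cut Q X (Owner x T R' D' :: es) ms) ->
  cut Q X (Owner x T R D :: es) ms.
Proof.
  intros [H1 [H2 [H3 H4]]] HS Hw IH.
  inversion_clear H2 as [|? ? HR He].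
  destruct (fwn_inv _ _ _ _ H1) as [_ [_ I]].
  unfold cut in *; simpl in *; rewrite <- app_assoc.
  apply (normalizes_commute X Q x T R D) with (w := w); auto.
  - apply I; now left.
  - rewrite fst_own; nodup.
  - intros R' D' L HR' N; rewrite fst_own in N.
    rewrite app_assoc; apply (IH R' D'); auto.
    repeat split; simpl; auto.
    now rewrite <- app_assoc.
Qed.

(** * Principal reductions *)

Lemma mem_cons_perm (x : name) X : mem x X -> exists X', Permutation X (x :: X').
Proof.
  intros H; apply in_split in H; destruct H as [l1 [l2 ->]].
  exists (l1 ++ l2); symmetry; apply Permutation_middle.
Qed.

Lemma nodup_disjoint l1 l2 : NoDup (l1 ++ l2) -> disjoint l1 l2.
Proof.
  intros H v K1 K2; apply in_split in K1, K2.
  destruct K1 as [a [b ->]], K2 as [c [d ->]].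
  assert (N : NoDup [v; v]) by nodup.
  inversion_clear N as [|? ? F _]; apply F; now left.
Qed.

(** The outer induction hypothesis. [Q] and [X] vary because receiving creates an inner cut with its
    own forwarder. *)
Definition smaller_cuts (k : nat) : Prop :=
  forall Q X es ms, ready Q X es ms -> weight es + weight ms < k ->
    cut Q X es ms.

(** After [red_close], [x] stays in [X] without an owner, as a terminated endpoint. *)
Lemma cut_bot x Q X es ms :
  fwn Q X (map key es) (map key ms) -> mem x X ->
  ready (Wait x Q) X (Owner x One (Close x) [] :: es) ms ->
  smaller_cuts (S (weight es + weight ms)) ->
  cut (Wait x Q) X (Owner x One (Close x) [] :: es) ms.
Proof.
  intros H HX [H1 [H2 [H3 H4]]] IH.
  inversion_clear H2 as [|? ? HR He].
  destruct (mem_cons_perm _ _ HX) as [X' EX].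
  eapply cut_perm; [exact EX|reflexivity|reflexivity|].
  unfold cut; simpl.
  eapply normalizes_step; [apply red_close|].
  eapply normalizes_equiv; [apply pe_comp_perm; [symmetry; exact EX| |]; reflexivity|].
  apply IH; [|lia]. repeat split; auto.
Qed.

(** All other endpoints are terminated, so [red_wait] leaves only [R], which is already cut-free. *)
Lemma cut_one x X R D : 
  ready (Close x) X [Owner x Bot (Wait x R) D] [] -> mem x X -> cpn R D ->
  cut (Close x) X [Owner x Bot (Wait x R) D] [].
Proof.
  intros [_ [_ [_ N]]] HX HR.
  destruct (mem_cons_perm _ _ HX) as [X' EX].
  eapply cut_perm; [exact EX|reflexivity|reflexivity|].
  unfold cut; simpl in *; rewrite !app_nil_r in *.
  eapply normalizes_step; [apply red_wait|now apply normalizes_cpn].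
  intros v K1 K2; rewrite (cpn_fn _ _ _ HR) in K2.
  apply (nodup_disjoint _ _ N v); auto.
  now apply (Permutation_in _ (Permutation_sym EX)).
Qed.

Lemma cut_ax x y z w a R R' :
  pequiv R (Link x z) -> pequiv R' (Link y w) ->
  ready (Link x y) [x; y] [Owner x (Atom a) R [(z, NAtom a)];
                           Owner y (NAtom a) R' [(w, Atom a)]] [] ->
  cut (Link x y) [x; y] [Owner x (Atom a) R [(z, NAtom a)];
                         Owner y (NAtom a) R' [(w, Atom a)]] [].
Proof.
  intros E E' [_ [_ [_ N]]]; unfold cut; simpl in *.
  eapply normalizes_equiv.
  (* [pe_comp_proc] rewrites the head component only, hence the two exchanges around the second
     link. *)
  { eapply pe_trans; [apply pe_comp_proc; exact E|].
    eapply pe_trans; [apply pe_comp_perm; [reflexivity|reflexivity|apply perm_swap]|].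
    eapply pe_trans; [apply pe_comp_proc; exact E'|].
    apply pe_comp_perm; [reflexivity|reflexivity|apply perm_swap]. }
  eapply normalizes_step; [apply red_link|].
  - apply nodup_disjoint; exact N.
  - apply normalizes_cpn, cpn_link with a; auto.
    intros ->; inversion_clear N as [|? ? _ N1]; inversion_clear N1 as [|? ? _ N2].
    inversion_clear N2 as [|? ? F _]; apply F; now left.
Qed.

(** The sent process goes into transit together with its context [D1]; the weight drops by one, the
    tensor itself. *)
Lemma cut_par x y v Q X A B P R D D1 D2 es ms :
  fwn Q X ((x, B) :: map key es) ((y, A) :: map key ms) ->
  ready (In x y Q) X (Owner x (Tensor A B) (Out x v P R) D :: es) ms ->
  cpn P ((v, A) :: D1) -> cpn R ((x, B) :: D2) -> Permutation D (D1 ++ D2) ->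
  smaller_cuts (tsize (Tensor A B) + weight es + weight ms) ->
  cut (In x y Q) X (Owner x (Tensor A B) (Out x v P R) D :: es) ms.
Proof.
  intros H [H1 [H2 [H3 H4]]] HP HR ED IH.
  inversion_clear H2 as [|? ? _ He].
  destruct (fwn_inv _ _ _ _ H) as [N1 [N2 I]].
  assert (HX : mem x X) by (apply I; now left).
  destruct (mem_cons_perm _ _ HX) as [X' EX].
  eapply cut_perm; [exact EX|reflexivity|reflexivity|].
  (* [red_send] needs forwarder and sender to bind the same name; both are renamed to [y']. *)
  destruct (fresh_exists ((x :: X' ++ fn R ++ fns (map own ms)
    ++ fns (map own es)) ++ fn Q ++ fn P ++ X ++ map ep ms
    ++ names (D ++ flat_map sg es ++ flat_map sg ms))) as [y' F].
  assert (F1 : fresh y' (x :: X' ++ fn R ++ fns (map own ms)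
    ++ fns (map own es))).
  { intros K; apply F, in_app_iff; now left. }
  assert (F2 : ~ mem y' (fn Q) /\ ~ mem y' (fn P) /\
    ~ mem y' (X ++ map ep ms ++ names (D ++ flat_map sg es ++ flat_map sg ms))).
  { repeat split; intros K; apply F; rewrite !in_app_iff in *; tauto. }
  clear F; destruct F2 as [FQ [FP F2]].
  assert (N' : NoDup (y' :: X ++ map ep ms
    ++ names (D ++ flat_map sg es ++ flat_map sg ms))).
  { constructor; [exact F2|]. simpl in H4; nodup. }
  unfold cut; simpl.
  eapply normalizes_equiv.
  { eapply pe_trans; [apply pe_comp_fwd, pe_in_alpha with (z := y'); exact FQ|].
    apply pe_comp_proc, pe_out_alpha with (z := y'); exact FP. }
  eapply normalizes_step; [apply red_send; exact F1|].
  apply (normalizes_perm _ (flat_map sg (Owner x B R D2 :: es)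
     ++ flat_map sg (Owner y' A (swap v y' P) D1 :: ms))).
  { simpl; rewrite ED.
    rewrite (Permutation_app_comm D1 D2), <- !app_assoc.
    apply Permutation_app_head. rewrite !app_assoc.
    apply Permutation_app_tail, Permutation_app_comm. }
  eapply normalizes_equiv; [apply pe_comp_perm; [symmetry; exact EX| |]; reflexivity|].
  apply (IH _ _ (Owner x B R D2 :: es) (Owner y' A (swap v y' P) D1 :: ms)).
  - repeat split; simpl.
    + apply fwn_rename; [exact H|].
      unfold fresh; rewrite names_key; intros K; apply F2.
      rewrite !in_app_iff in *; tauto.
    + constructor; auto.
    + constructor; auto. apply cpn_rename; [|exact HP].
      intros K; apply F2; rewrite names_app, !in_app_iff.
      rewrite (mem_perm_names _ _ _ ED), names_app, in_app_iff; tauto.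
    + nodup.
  - rewrite !weight_cons; simpl; lia.
Qed.

(** Two uses of the induction hypothesis: on the inner cut of [A] against its dual, then on the
    outer one at [B]. The inner weight is twice [tsize A]; one half is paid by the received message,
    the other by the type [Par A B]. *)
Lemma cut_tensor x y z v S Q X A B P Dz R D es ms :
  fwn S [z; y] [(z, dual A); (y, A)] [] ->
  fwn Q X ((x, B) :: map key es) (map key ms) ->
  ready (Out x y S Q) X (Owner x (Par A B) (In x v R) D :: es)
    (Owner z (dual A) P Dz :: ms) ->
  cpn R ((v, A) :: (x, B) :: D) ->
  smaller_cuts (tsize (Par A B) + weight es + (tsize (dual A) + weight ms)) ->
  cut (Out x y S Q) X (Owner x (Par A B) (In x v R) D :: es)
    (Owner z (dual A) P Dz :: ms).
Proof.
  intros HS HQ [H1 [H2 [H3 H4]]] HR IH.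
  inversion_clear H2 as [|? ? _ He]; inversion_clear H3 as [|? ? HP Hm].
  unfold typed in HP; simpl in HP.
  destruct (fwn_inv _ _ _ _ HQ) as [N1 [N2 I]].
  assert (HX : mem x X) by (apply I; now left).
  destruct (mem_cons_perm _ _ HX) as [X' EX].
  eapply cut_perm; [exact EX|reflexivity|reflexivity|].
  destruct (fresh_exists ((x :: fn P) ++ fn S ++ fn R ++ [z] ++ X
    ++ names (D ++ Dz))) as [y' F].
  assert (F1 : fresh y' (x :: fn P) /\ ~ mem y' (fn S) /\ ~ mem y' (fn R) /\
    y' <> z /\ ~ mem y' X /\ ~ mem y' (names (D ++ Dz))).
  { unfold fresh; repeat split; intros K; apply F; rewrite !in_app_iff;
      (subst; simpl in *; tauto). }
  clear F; destruct F1 as [FP [FS [FR [Fz [FX FD]]]]].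
  assert (F2 : fresh y' (names ((x, B) :: D))).
  { intros [<-|K]; [now apply FX|]. apply FD; rewrite names_app, in_app_iff; auto. }
  apply (cpn_rename _ y') in HR as HR'; [|exact F2].
  apply (fwn_rename_pair _ y') in HS as HS'; [|exact Fz].
  (* The message name [z] moves from the outer binder to the inner one, so it must occur nowhere
     else in the outer term. *)
  assert (Nz : ~ mem z (X ++ map ep ms
    ++ names ((D ++ flat_map sg es) ++ Dz ++ flat_map sg ms))).
  { simpl in H4; apply NoDup_remove_2 in H4; exact H4. }
  unfold cut; simpl.
  eapply normalizes_equiv.
  { eapply pe_trans; [apply pe_comp_fwd, pe_out_alpha with (z := y'); exact FS|].
    apply pe_comp_proc, pe_in_alpha with (z := y'); exact FR. }
  eapply normalizes_step; [apply red_receive; auto|].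
  { intros u; rewrite (fwn_fn _ _ _ _ _ HS'); simpl; intuition. }
  { intros K.
    assert (K' : mem z (x :: X') \/ mem z (fn Q) \/ mem z (fn (swap v y' R))
      \/ mem z (fns (map own ms)) \/ mem z (fns (map own es))).
    { simpl in *; rewrite !in_app_iff in K; tauto. }
    clear K; apply Nz.
    assert (HE : forall u, mem u (map ep es) -> mem u X).
    { intros u K; apply I; simpl; rewrite names_key; auto. }
    rewrite !names_app, !in_app_iff.
    destruct K' as [K|[K|[K|[K|K]]]].
    - left; now apply (Permutation_in _ (Permutation_sym EX)).
    - rewrite (fwn_fn _ _ _ _ _ HQ), names_key in K.
      destruct K as [K|K]; auto.
    - rewrite (cpn_fn _ _ _ HR') in K; destruct K as [K|[K|K]]; simpl in K;
        subst; tauto.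
    - apply fns_own in K; tauto.
    - apply fns_own in K; auto. destruct K as [K|K]; auto; tauto. }
  (* In the inner cut [x] is an ordinary free name of the receiver; in the result it is again the
     owned endpoint, now at type [B]. *)
  destruct (IH (swap y y' S) [y'; z]
    [Owner y' A (swap v y' R) ((x, B) :: D); Owner z (dual A) P Dz] [])
    as [T [K1 K2]].
  { repeat split; simpl.
    - eapply fwn_perm; [exact HS'| | |]; auto using perm_swap.
    - repeat constructor; assumption.
    - constructor.
    - assert (N : NoDup (y' :: z :: x :: names (D ++ Dz))).
      { constructor.
        - intros [K|[K|K]]; auto. subst; auto.
        - simpl in H4; nodup. }
      nodup. }
  { rewrite !weight_cons, !tsize_dual; change (weight []) with 0; simpl; lia. }
  (* The result is only known to be typed in [cp]; an equivalent [T'] typed in [cpn] becomes the new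
     owner of [x]. *)
  simpl in K1, K2; rewrite !app_nil_r in K2.
  apply cp_cpn in K2; destruct K2 as [T' [E K2]].
  eapply normalizes_steps.
  { apply reds_map with (f := fun R => Comp (x :: X') Q (map own ms)
      ((x, R) :: map own es)); [|exact K1].
    intros; now apply red_ctx_proc. }
  eapply normalizes_equiv; [apply pe_comp_proc; exact E|].
  eapply normalizes_perm with (D := flat_map sg (Owner x B T' (D ++ Dz) :: es)
     ++ flat_map sg ms).
  { simpl; rewrite <- !app_assoc; apply Permutation_app_head.
    rewrite !app_assoc; apply Permutation_app_tail, Permutation_app_comm. }
  eapply normalizes_equiv; [apply pe_comp_perm; [symmetry; exact EX| |]; reflexivity|].
  apply (IH _ _ (Owner x B T' (D ++ Dz) :: es) ms).
  - repeat split; auto. simpl in *; nodup.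
  - rewrite weight_cons; simpl; lia.
Qed.

(** * The lexicographic induction *)

(** The [try] discards [view_comm], whose subject differs from the endpoint, against [S]. *)
Ltac invert_view V S :=
  inversion V; subst;
  try match goal with K : subject _ = Some _ |- _ => now apply S in K end.

Lemma cut_step Q X es ms :
  ready Q X es ms -> smaller_cuts (weight es + weight ms) ->
  (forall es', ready Q X es' ms -> weight es' = weight es ->
     bulk es' < bulk es -> cut Q X es' ms) ->
  cut Q X es ms.
Proof.
  intros H IHw IHb.
  (* For any owner, a foreign first action settles the goal by commuting and [IHb]; otherwise only
     the principal views remain. *)
  assert (HV : forall x T R D es', Permutation es (Owner x T R D :: es') ->
    cut Q X es ms \/
    (view x T R D /\ (forall w, subject R = Some w -> w = x))).
  { intros x T R D es' E.
    pose proof (ready_perm _ _ _ _ _ _ _ (Permutation_refl _) E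
      (Permutation_refl _) H) as H'.
    assert (HR : typed (Owner x T R D)).
    { destruct H' as [_ [K _]]; now inversion_clear K. }
    apply cpn_view in HR.
    destruct (subject R) as [w|] eqn:HS.
    - destruct (Nat.eq_dec w x) as [->|Hw].
      + right; split; auto; intros w K; congruence.
      + left; eapply cut_perm; [reflexivity|exact E|reflexivity|].
        eapply cut_commute; eauto.
        intros R' D' L HR'; apply IHb; auto.
        * rewrite (weight_perm _ _ E), !weight_cons; lia.
        * rewrite (bulk_perm _ _ E), !bulk_cons; lia.
    - right; split; auto; intros w K; congruence. }
  destruct H as [HF H].
  remember (map key es) as E0 eqn:EE; remember (map key ms) as M0 eqn:EM.
  destruct HF as [x y a X E Hxy HX HE|x X HN HX|x P X E E' M HX HE HF HE'
    |x y P X E E' M A B HF HE'|x y z S P X E E' M M' A B Fz HS HF HE' HM'].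
  - symmetry in EM; apply map_eq_nil in EM; subst.
    pose proof (pick_key _ _ _ _ HE) as [R [D [es1 [K1 K2]]]].
    apply Permutation_length_1_inv in K2.
    destruct es1 as [|[y0 T0 R' D'] [|]]; try discriminate K2.
    injection K2 as -> ->.
    (* [red_link] fires only when both owners are links, so both are inspected. *)
    destruct (HV _ _ _ _ _ K1) as [|[V1 S1]]; auto.
    destruct (HV y (NAtom a) R' D' [Owner x (Atom a) R D]) as [|[V2 S2]]; auto.
    { rewrite K1; apply perm_swap. }
    invert_view V1 S1.
    invert_view V2 S2.
    eapply cut_perm; [exact HX|exact K1|reflexivity|].
    eapply cut_ax; eauto.
    eapply ready_perm; [exact HX|exact K1|reflexivity|].
    split; [|exact H]. now apply fwn_ax with a.
  - symmetry in EM; apply map_eq_nil in EM; subst.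
    destruct es as [|[x0 T0 R D] [|]]; try discriminate EE.
    injection EE as <- <-.
    destruct (HV _ _ _ _ _ (Permutation_refl _)) as [|[V1 S1]]; auto.
    invert_view V1 S1.
    apply cut_one; auto. split; [|exact H]. now constructor.
  - subst; destruct (pick_key _ _ _ _ HE') as [R [D [es' [K1 K2]]]].
    destruct (HV _ _ _ _ _ K1) as [|[V1 S1]]; auto.
    invert_view V1 S1.
    assert (HF' : fwn P X (map key es') (map key ms))
      by (eapply fwn_perm; [exact HF| | |]; auto).
    eapply cut_perm; [reflexivity|exact K1|reflexivity|].
    apply cut_bot; auto.
    + eapply ready_perm; [reflexivity|exact K1|reflexivity|].
      split; [|exact H]. apply fwn_bot with E; auto.
    + intros Q1 X1 es1 ms1 R1 L; apply IHw; auto.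
      rewrite (weight_perm _ _ K1), weight_cons; exact L.
  - subst; destruct (pick_key _ _ _ _ HE') as [R [D [es' [K1 K2]]]].
    destruct (HV _ _ _ _ _ K1) as [|[V1 S1]]; auto.
    invert_view V1 S1.
    assert (HF' : fwn P X ((x, B) :: map key es') ((y, A) :: map key ms))
      by (eapply fwn_perm; [exact HF| | |]; auto).
    eapply cut_perm; [reflexivity|exact K1|reflexivity|].
    eapply cut_par; eauto.
    + eapply ready_perm; [reflexivity|exact K1|reflexivity|].
      split; [|exact H]. eapply fwn_par; [exact HF|exact HE'].
    + intros Q1 X1 es1 ms1 R1' L; apply IHw; auto.
      rewrite (weight_perm _ _ K1), weight_cons; lia.
  - subst; destruct (pick_key _ _ _ _ HE') as [R [D [es' [K1 K2]]]].
    destruct (pick_key _ _ _ _ HM') as [Pz [Dz [ms' [K3 K4]]]].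
    destruct (HV _ _ _ _ _ K1) as [|[V1 S1]]; auto.
    invert_view V1 S1.
    assert (HF' : fwn P X ((x, B) :: map key es') (map key ms'))
      by (eapply fwn_perm; [exact HF| | |]; auto).
    eapply cut_perm; [reflexivity|exact K1|exact K3|].
    eapply cut_tensor; eauto.
    + eapply ready_perm; [reflexivity|exact K1|exact K3|].
      split; [|exact H]. eapply fwn_tensor; [exact Fz|exact HS|exact HF|exact HE'|exact HM'].
    + intros Q1 X1 es1 ms1 R1' L; apply IHw; auto.
      rewrite (weight_perm _ _ K1), (weight_perm _ _ K3), !weight_cons; lia.
Qed.

(** [k] bounds the weight. The inner induction on [bulk es] keeps [Q], [X] and [ms] fixed, since a
    commuting conversion changes a single owner. *)
Lemma cut_elimination k : smaller_cuts k.
Proof.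
  induction k as [|k IHk]; [intros Q X es ms _ L; lia|].
  intros Q X es ms; remember (bulk es) as n eqn:En.
  revert es En; induction n as [n IHn] using lt_wf_ind; intros es -> H L.
  apply cut_step; auto.
  - intros Q' X' es' ms' H' L'; apply IHk; auto; lia.
  - intros es' H' Ew Lb; eapply IHn; eauto. lia.
Qed.

(** * The initial configuration *)

(** The prefix [cs] holds the components already passed, so that the induction can replace the
    remaining ones in place. *)
Lemma cp_owners (R : nat -> proc) (x : nat -> name) (A : nat -> ty)
    (Sigma : nat -> ctx) (l : list nat) :
  (forall i, mem i l -> cp (R i) (Sigma i ++ [(x i, A i)])) ->
  exists es, map key es = map (fun i => (x i, A i)) l /\
    flat_map sg es = flat_map Sigma l /\ Forall typed es /\
    forall xs Q ms cs,
      pequiv (Comp xs Q ms (cs ++ map (fun i => (x i, R i)) l))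
        (Comp xs Q ms (cs ++ map own es)).
Proof.
  induction l as [|i l IH]; intros H.
  - exists []; repeat split; auto; intros; apply pe_refl.
  - destruct IH as [es [E1 [E2 [E3 E4]]]]; [intros; apply H; now right|].
    destruct (cp_cpn _ _ (H i (or_introl eq_refl))) as [R' [E K]].
    exists (Owner (x i) (A i) R' (Sigma i) :: es); repeat split; simpl.
    + now rewrite E1.
    + now rewrite E2.
    + constructor; auto. eapply cpn_perm; [|exact K].
      symmetry; apply Permutation_cons_append.
    + intros xs Q ms cs.
      pose proof (E4 xs Q ms (cs ++ [(x i, R i)])) as E5.
      rewrite <- !app_assoc in E5; eapply pe_trans; [exact E5|].
      eapply pe_trans; [apply pe_comp_perm; [reflexivity|reflexivity|]|].
      { symmetry; apply Permutation_middle. }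
      eapply pe_trans; [apply pe_comp_proc; exact E|].
      apply pe_comp_perm; [reflexivity|reflexivity|apply Permutation_middle].
Qed.

Lemma nodup_flat_map (Sigma : nat -> ctx) l :
  NoDup l -> (forall i, mem i l -> NoDup (names (Sigma i))) ->
  (forall i j, mem i l -> mem j l -> i <> j ->
     disjoint (names (Sigma i)) (names (Sigma j))) ->
  NoDup (names (flat_map Sigma l)).
Proof.
  induction 1 as [|i l Hi Hl IH]; intros H1 H2; [constructor|].
  simpl; rewrite names_app; apply NoDup_app.
  - apply H1; now left.
  - apply IH; intros; [apply H1|apply H2]; simpl; auto.
  - intros v K1 K2; unfold names in K2; apply in_map_iff in K2.
    destruct K2 as [[v' B] [<- K2]]; apply in_flat_map in K2.
    destruct K2 as [j [Kj K2]].
    apply (H2 i j) with (fst (v', B)); simpl; auto; [now intros ->|].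
    exact (in_map fst _ _ K2).
Qed.

Theorem theorem2 (n : nat) (x : nat -> name) (R : nat -> proc)
    (Sigma : nat -> ctx) (A : nat -> ty) (A' : nat -> aty) (Q : proc)
    (HR : forall i, i < n -> cp (R i) (Sigma i ++ [(x i, A i)]))
    (HQ : fwd Q (map (fun i => Ent [] (x i) (Some (A' i))) (seq 0 n)))
    (HA : forall i, i < n -> erase (A' i) = dual (A i))
    (HSS : forall i j, i < n -> j < n -> i <> j ->
       disjoint (names (Sigma i)) (names (Sigma j)))
    (HSx : forall i, i < n ->
       disjoint (names (Sigma i)) (map x (seq 0 n))) :
  exists S : proc,
    reds (Comp (map x (seq 0 n)) Q [] (map (fun i => (x i, R i)) (seq 0 n))) S
    /\ cp S (flat_map Sigma (seq 0 n)).
Proof.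
  assert (Hn : forall i, mem i (seq 0 n) -> i < n)
    by (intros i K; apply in_seq in K; lia).
  destruct (cp_owners R x A Sigma (seq 0 n)) as [es [E1 [E2 [E3 E4]]]]; auto.
  destruct (fwd_fwn _ _ HQ) as [Q' [EQ HF]].
  (* Initially every endpoint is live and nothing is in transit; by involutivity [live] lists the
     owners' types [A i]. *)
  assert (F1 : ends (map (fun i => Ent [] (x i) (Some (A' i))) (seq 0 n))
     = map x (seq 0 n)) by (unfold ends; now rewrite map_map).
  assert (F2 : live (map (fun i => Ent [] (x i) (Some (A' i))) (seq 0 n))
     = map (fun i => (x i, A i)) (seq 0 n)).
  { clear - HA Hn; induction (seq 0 n) as [|i l IH]; simpl; auto.
    rewrite IH, HA, dual_involutive; auto; intros; apply Hn; simpl; auto. }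
  assert (F3 : transit (map (fun i => Ent [] (x i) (Some (A' i))) (seq 0 n))
     = []) by (clear; induction (seq 0 n); simpl; auto).
  rewrite F1, F2, F3, <- E1 in HF.
  assert (C : cut Q' (map x (seq 0 n)) es []).
  { eapply cut_elimination; [|apply Nat.lt_succ_diag_r].
    split; [exact HF|]. repeat split; auto.
    (* The forwarder judgement gives distinctness of the [x i], and CP typing that of the names
       within each [Sigma i]. *)
    destruct (fwn_inv _ _ _ _ HF) as [N _].
    simpl in *; rewrite !app_nil_r in *; rewrite E2.
    apply NoDup_app; auto.
    - apply nodup_flat_map; auto using seq_NoDup.
      intros i K; apply Hn, HR, cp_cpn in K; destruct K as [P [_ K]].
      apply cpn_nodup in K; nodup.
    - intros v K1 K2; unfold names in K2; apply in_map_iff in K2.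
      destruct K2 as [[v' B] [<- K2]]; apply in_flat_map in K2.
      destruct K2 as [j [Kj K2]].
      apply (HSx j (Hn j Kj) v'); auto. exact (in_map fst _ _ K2). }
  unfold cut in C; simpl in C; rewrite app_nil_r, E2 in C.
  change (normalizes (Comp (map x (seq 0 n)) Q []
    (map (fun i => (x i, R i)) (seq 0 n))) (flat_map Sigma (seq 0 n))).
  eapply normalizes_equiv; [|exact C].
  eapply pe_trans; [apply (E4 _ _ _ [])|]. now apply pe_comp_fwd.
Qed.
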